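(* Let $G$ be a $(P_5, C_4)$-free graph and let $\ell \ge \chi(G)+1$ be an integer. Then $\mathcal{R}_\ell(G)$ is connected.
   Context: All graphs are finite and simple. A $k$-colouring of $G$ is a map $\alpha: V(G)\to\{1,\dots,k\}$ with $\alpha(u)\neq\alpha(v)$ for every edge $uv$; $\chi(G)$ is the chromatic number. The reconfiguration graph $\mathcal{R}_k(G)$ has the $k$-colourings of $G$ as vertices, two being adjacent if they differ on exactly one vertex. A graph is $(H_1,H_2)$-free if it has no induced subgraph isomorphic to $H_1$ or $H_2$; $P_5$ is the path on 5 vertices and $C_4$ the 4-cycle. *)

(* Defs.v *)
From mathcomp Require Import all_boot.
Set Implicit Arguments. Unset Strict Implicit. Unset Printing Implicit Defensive.

Definition simple_graph (T : finType) (e : rel T) : Prop :=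
  symmetric e /\ irreflexive e.

Definition P5_adj : rel 'I_5 :=
  fun i j => (i.+1 == j :> nat) || (j.+1 == i :> nat).
Definition C4_adj : rel 'I_4 :=
  fun i j => ((i.+1 %% 4) == j :> nat) || ((j.+1 %% 4) == i :> nat).

Definition has_induced (T : finType) (e : rel T) (n : nat) (h : rel 'I_n) : Prop :=
  exists f : 'I_n -> T, injective f /\ forall i j, e (f i) (f j) = h i j.

Definition P5_C4_free (T : finType) (e : rel T) : Prop :=
  ~ has_induced e P5_adj /\ ~ has_induced e C4_adj.

Definition proper_col (T : finType) (e : rel T) (k : nat) (c : {ffun T -> 'I_k}) : bool :=
  [forall u, forall v, e u v ==> (c u != c v)].

Definition colourable (T : finType) (e : rel T) (k : nat) : bool :=
  [exists c : {ffun T -> 'I_k}, proper_col e c].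

(* chromatic number: least k such that G is k-colourable
   (G is always #|T|-colourable, so the search range 0..#|T| suffices). *)
Definition chi (T : finType) (e : rel T) : nat :=
  find (fun k => colourable e k) (iota 0 #|T|.+1).

Definition recol_adj (T : finType) (e : rel T) (k : nat) : rel {ffun T -> 'I_k} :=
  fun a b => [&& proper_col e a, proper_col e b & #|[set v | a v != b v]| == 1].

Definition recol_connected (T : finType) (e : rel T) (k : nat) : Prop :=
  forall a b : {ffun T -> 'I_k}, proper_col e a -> proper_col e b ->
    connect (@recol_adj T e k) a b.

(* Main.v *)
(* Every nonempty (P5, C4)-free graph has a nonempty vertex set B without stable
   set of size 3 whose outside neighbourhood K is a clique, complete to B: if some
   vertex lies on an induced C5, take the vertices having both a neighbour and a
   non-neighbour on the cycle (a blow-up of C5; K is then the set of vertices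
   complete to the cycle); otherwise the graph is chordal and B is a simplicial
   vertex. As the colours on K are barred from B, the colourings of B with a fixed
   colouring of K form a reconfiguration graph with at least chi(G[B]) + 1 colours,
   and it is connected because the classes in B have at most two vertices: those of
   a target colouring with a spare colour can be created one after the other.
   Induction: follow a recolouring of G - B, and before a vertex outside B receives
   a colour, recolour B so as to avoid that colour. *)
Require Import Defs.
From mathcomp Require Import all_boot.
Set Implicit Arguments. Unset Strict Implicit. Unset Printing Implicit Defensive.

(** * Structure of (P5, C4)-free graphs *)
Section Structure.
Variables (T : finType) (e : rel T).
Hypotheses (e_sym : symmetric e) (e_irr : irreflexive e).
Hypothesis e_free : P5_C4_free e.

Definition clique (A : {set T}) : bool :=
  [forall x in A, forall y in A, (x != y) ==> e x y].

Lemma cliqueP (A : {set T}) :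
  reflect (forall x y, x \in A -> y \in A -> x != y -> e x y) (clique A).
Proof.
apply: (iffP forall_inP) => [h x y xA yA|h x xA].
  by have /forall_inP/(_ _ yA)/implyP := h x xA.
by apply/forall_inP => y yA; apply/implyP; apply: h.
Qed.

(** The pattern forces the five vertices to be distinct. The non-edges are oriented so that rotating
    the cycle merely permutes the conditions. *)
Definition C5 a b c d f :=
  [&& e a b, e b c, e c d, e d f, e f a,
      ~~ e a c, ~~ e b d, ~~ e c f, ~~ e d a & ~~ e f b].

(** Distinctness comes for free: no two vertices of a 5-path have the same neighbours, so a map that
    preserves edges and non-edges is injective. *)
Lemma no_P5 a b c d f :
  [&& e a b, e b c, e c d & e d f] ->
  ~~ [&& ~~ e a c, ~~ e a d, ~~ e a f, ~~ e b d, ~~ e b f & ~~ e c f].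
Proof.
case/and4P=> ab bc cd df; apply/negP; case/and5P=> ac ad af bd /andP[bf cf].
case: e_free => + _; apply; pose g (i : 'I_5) := nth a [:: a; b; c; d; f] i.
have ge i j : e (g i) (g j) = P5_adj i j.
  case: i j => [[|[|[|[|[|//]]]]] ?] [[|[|[|[|[|//]]]]] ?] /=;
  rewrite /g /P5_adj /= ?e_irr //; solve [ by [] | by apply/negbTE |
    by rewrite e_sym // ; apply/negbTE].
exists g; split=> // i j gij.
have rows k : P5_adj i k = P5_adj j k by rewrite -!ge gij.
apply: val_inj; move: (rows (@Ordinal 5 0 isT)) (rows (@Ordinal 5 1 isT)).
move: (rows (@Ordinal 5 2 isT)) (rows (@Ordinal 5 3 isT)) => {rows gij}.
by case: i j => [[|[|[|[|[|//]]]]] ?] [[|[|[|[|[|//]]]]] ?].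
Qed.

(** Opposite vertices of a 4-cycle are twins, so their distinctness has to be assumed. *)
Lemma no_C4 a b c d :
  [&& e a b, e b c, e c d & e d a] -> a != c -> b != d -> e a c || e b d.
Proof.
case/and4P=> ab bc cd da a_c b_d; apply/norP => -[ac bd].
case: e_free => _; apply; pose g (i : 'I_4) := nth a [:: a; b; c; d] i.
have e_neq x y : e x y -> x != y by apply: contraTneq => ->; rewrite e_irr.
exists g; split.
  have: uniq [:: a; b; c; d].
    by rewrite /= !inE !negb_or a_c b_d (eq_sym a d) !e_neq.
  by move=> /uniqP-/(_ a) u i j /(u _ _ (ltn_ord i) (ltn_ord j))/val_inj.
case=> [[|[|[|[|//]]]] ?] [[|[|[|[|//]]]] ?] /=;
  rewrite /g /C4_adj /= ?e_irr //; solve [ by [] | by apply/negbTE |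
    by rewrite e_sym // ; apply/negbTE].
Qed.

(** * Vertices attached to an induced 5-cycle *)

Lemma C5_rot a b c d f : C5 a b c d f = C5 b c d f a.
Proof. by rewrite /C5; do 10!case: (e _ _). Qed.

Definition mixed a b c d f v :=
  [|| e v a, e v b, e v c, e v d | e v f] &&
  ~~ [&& e v a, e v b, e v c, e v d & e v f].

(* [v] looks like [a] from the rest of the 5-cycle: it may replace [a] there. *)
Definition alike b c d f v := [&& e v b, e v f, ~~ e v c & ~~ e v d].

(** Otherwise [v a b c d] is an induced 5-path. *)
Lemma C5_pendant a b c d f v :
  C5 a b c d f -> e v a -> ~~ [&& ~~ e v b, ~~ e v c & ~~ e v d].
Proof.
case/and5P=> ab bc cd df /and5P[fa ac bd cf /andP[da fb]] va.
have := @no_P5 v a b c d; rewrite va ab bc cd => /(_ isT).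
by rewrite ac bd (e_sym a d) da /= !andbT.
Qed.

(** For [v] other than [a], a missing edge [v a] would make [v b a f] an induced 4-cycle. *)
Lemma C5_cherry a b c d f v :
  C5 a b c d f -> e v b -> e v f -> e v a || ~~ e v c && ~~ e v d.
Proof.
case/and5P=> ab bc cd df /and5P[fa ac bd cf /andP[da fb]] vb vf.
have [-> | v_a] := eqVneq v a; first by rewrite ac (e_sym a d) da orbT.
have b_f : b != f by apply: contraTneq bc => ->; rewrite e_sym.
have := @no_C4 v b a f; rewrite vb (e_sym b) ab (e_sym a) fa (e_sym f v) vf.
by move=> /(_ isT v_a b_f); rewrite (e_sym b) (negbTE fb) orbF => ->.
Qed.

(** [C5_pendant] and [C5_cherry] at all five rotations exclude every other adjacency pattern of [v]
    to the cycle; a Boolean case check confirms this. *)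
Lemma mixed_alike a b c d f v :
  C5 a b c d f -> mixed a b c d f v ->
  [|| alike b c d f v, alike c d f a v, alike d f a b v, alike f a b c v
    | alike a b c d v].
Proof.
move=> C.
have step p q r s t : C5 p q r s t -> [/\ C5 q r s t p,
    e v p ==> ~~ [&& ~~ e v q, ~~ e v r & ~~ e v s] &
    (e v q && e v t) ==> (e v p || ~~ e v r && ~~ e v s)].
  move=> Cp; split; first by rewrite -C5_rot.
    by apply/implyP; apply: C5_pendant Cp.
  by apply/implyP => /andP[]; apply: C5_cherry Cp.
have [C1 P1 Q1] := step _ _ _ _ _ C; have [C2 P2 Q2] := step _ _ _ _ _ C1.
have [C3 P3 Q3] := step _ _ _ _ _ C2; have [C4 P4 Q4] := step _ _ _ _ _ C3.
have [_ P5 Q5] := step _ _ _ _ _ C4; rewrite /mixed /alike.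
move: P1 Q1 P2 Q2 P3 Q3 P4 Q4 P5 Q5.
by case: (e v a); case: (e v b); case: (e v c); case: (e v d); case: (e v f).
Qed.

Definition full a b c d f v := [&& e v a, e v b, e v c, e v d & e v f].

(** Lets later proofs assume, without loss of generality, that a mixed vertex replaces the first
    vertex of the cycle. *)
Lemma mixed_rot a b c d f : C5 a b c d f -> forall v, mixed a b c d f v ->
  exists p q r s t, [/\ C5 p q r s t, alike q r s t v,
    mixed p q r s t =1 mixed a b c d f & full p q r s t =1 full a b c d f].
Proof.
move=> C v /(mixed_alike C).
have rot p q r s t : C5 p q r s t -> [/\ C5 q r s t p,
    mixed q r s t p =1 mixed p q r s t & full q r s t p =1 full p q r s t].
  rewrite C5_rot => Cp; split=> // x; rewrite /mixed /full;
  by do 5!case: (e x _).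
have [C1 M1 F1] := rot _ _ _ _ _ C; have [C2 M2 F2] := rot _ _ _ _ _ C1.
have [C3 M3 F3] := rot _ _ _ _ _ C2; have [C4 M4 F4] := rot _ _ _ _ _ C3.
case/or4P=> [||| /orP[]] hv.
- by exists a, b, c, d, f.
- by exists b, c, d, f, a.
- by exists c, d, f, a, b; split=> // x; rewrite ?M2 ?F2 ?M1 ?F1.
- by exists d, f, a, b, c; split=> // x; rewrite ?M3 ?F3 ?M2 ?F2 ?M1 ?F1.
- by exists f, a, b, c, d; split=> // x; rewrite ?M4 ?F4 ?M3 ?F3 ?M2 ?F2 ?M1 ?F1.
Qed.

(** Otherwise [x b y f] is an induced 4-cycle. *)
Lemma alike_clique a b c d f x y : C5 a b c d f ->
  alike b c d f x -> alike b c d f y -> x != y -> e x y.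
Proof.
case/and5P=> ab bc cd df /and5P[fa ac bd cf /andP[da fb]].
case/and4P=> xb xf xc xd /and4P[yb yf _ _] xy.
have b_f : b != f by apply: contraTneq bc => ->; rewrite e_sym.
have := @no_C4 x b y f; rewrite xb (e_sym b) yb yf (e_sym f x) xf.
by move=> /(_ isT xy b_f); rewrite (e_sym b) (negbTE fb) orbF.
Qed.

(** Otherwise [x f d c y] is an induced 5-path. *)
Lemma alike_next a b c d f x y : C5 a b c d f ->
  alike b c d f x -> alike c d f a y -> e x y.
Proof.
case/and5P=> ab bc cd df /and5P[fa ac bd cf /andP[da fb]].
case/and4P=> xb xf xc xd /and4P[yc ya yd yf].
have := @no_P5 x f d c y; rewrite xf (e_sym f) df (e_sym d) cd (e_sym c) yc.
move=> /(_ isT); rewrite xd xc (e_sym f c) cf (e_sym f y) yf (e_sym d y) yd.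
by rewrite /= !andbT negbK.
Qed.

(** Rotate so that [x] replaces the first vertex. A mixed non-neighbour of [x] then replaces one of
    the two opposite vertices; as these are consecutive, two such non-neighbours are adjacent. *)
Lemma mixed_no_stable3 a b c d f x y z : C5 a b c d f ->
  mixed a b c d f x -> mixed a b c d f y -> mixed a b c d f z ->
  x != y -> y != z -> x != z -> [|| e x y, e y z | e x z].
Proof.
move=> + Mx My Mz xy yz xz => /mixed_rot/(_ x Mx) [p [q [r [s [t]]]]].
case=> C Ax M _; rewrite -M in My; rewrite -M in Mz.
have C1 := C; rewrite C5_rot in C1; have C2 := C1; rewrite C5_rot in C2.
have C3 := C2; rewrite C5_rot in C3; have C4 := C3; rewrite C5_rot in C4.
have near w : mixed p q r s t w -> x != w ->
    [|| e x w, alike s t p q w | alike t p q r w].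
  move=> Mw xw; case/or4P: (mixed_alike C Mw) => [||| /orP[]] Aw.
  - by rewrite (alike_clique C Ax Aw).
  - by rewrite (alike_next C Ax Aw).
  - by rewrite Aw orbT.
  - by rewrite Aw !orbT.
  - by rewrite e_sym (alike_next C4 Aw Ax).
case/or3P: (near y My xy) => [-> // | Ay | Ay];
case/or3P: (near z Mz xz) => [-> | Az | Az]; rewrite ?orbT //.
- by rewrite (alike_clique C2 Ay Az) ?orbT.
- by rewrite (alike_next C2 Ay Az) ?orbT.
- by rewrite (e_sym y) (alike_next C2 Az Ay) ?orbT.
- by rewrite (alike_clique C3 Ay Az) ?orbT.
Qed.

(** If [w] saw nothing of the cycle, it would extend [v] and three consecutive cycle vertices to an
    induced 5-path. *)
Lemma mixed_nbr_full a b c d f v w : C5 a b c d f ->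
  mixed a b c d f v -> ~~ mixed a b c d f w -> e v w -> full a b c d f w.
Proof.
move=> + Mv => /mixed_rot/(_ v Mv) [p [q [r [s [t]]]]] [C Av M F] + vw.
rewrite -M -F /mixed /full => {M F Mv}; case/and4P: Av => vq vt vr vs.
case/and5P: C => pq qr rs st /and5P[tp pr qs rt /andP[sp tq]].
have := @no_P5 w v q r s; rewrite (e_sym w v) vw vq qr rs => /(_ isT).
by rewrite vr vs qs; do 5!case: (e w _).
Qed.

(** Otherwise [w], [v] and the two cycle neighbours of the position of [v] induce a 4-cycle. *)
Lemma full_mixed a b c d f v w : C5 a b c d f ->
  full a b c d f w -> mixed a b c d f v -> e w v.
Proof.
move=> + Fw Mv => /mixed_rot/(_ v Mv) [p [q [r [s [t]]]]] [C Av M F].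
move: Fw; rewrite -F => /and5P[wp wq wr ws wt].
case/and4P: Av => vq vt vr vs.
case/and5P: C => pq qr rs st /and5P[tp pr qs rt /andP[sp tq]].
have w_v : w != v by apply: contraTneq wr => ->.
have q_t : q != t by apply: contraTneq qr => ->; rewrite e_sym.
have := @no_C4 w q v t; rewrite wq (e_sym q) vq vt (e_sym t w) wt.
by move=> /(_ isT w_v q_t); rewrite (e_sym q) (negbTE tq) orbF.
Qed.

Lemma full_clique a b c d f v w : C5 a b c d f ->
  full a b c d f v -> full a b c d f w -> v != w -> e v w.
Proof.
case/and5P=> ab bc cd df /and5P[fa ac bd cf /andP[da fb]].
move=> /and5P[va vb vc vd vf] /and5P[wa wb wc wd wf] vw.
have a_c : a != c by apply: contraTneq cd => <-; rewrite e_sym.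
have := @no_C4 v a w c; rewrite va (e_sym a) wa wc (e_sym c v) vc.
by move=> /(_ isT vw a_c); rewrite (negbTE ac) orbF.
Qed.

(** * Simplicial vertices in the absence of induced 5-cycles *)

Definition nbrs (U : {set T}) x := [set y in U | e x y].

(* Dirac's theorem on chordal graphs, in a form that supports induction. *)
Lemma far_simplicial (U : {set T}) a y :
  {in U &, forall p q, {in U & &, forall r s t, ~~ C5 p q r s t}} ->
  a \in U -> y \in U -> y != a -> ~~ e a y ->
  exists x, [/\ x \in U, x != a, ~~ e a x & clique (nbrs U x)].
Proof.
have [n] := ubnP #|U|; elim: n U a y => // n IH U a y ltUn noC5 aU yU ya nay.
(* [D] is the component of [y] among the non-neighbours of [a], and [S] is the set of neighbours of
   [a] attached to [D]. *)
pose W := [set x in U | (x != a) && ~~ e a x].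
pose r := [rel x z | [&& e x z, x \in W & z \in W]].
pose D := [set z in W | connect r y z].
pose S := [set s in U | e a s && [exists z in D, e s z]].
have r_sym : connect_sym r.
  apply: sym_connect_sym => x z /=.
  by rewrite e_sym; congr (_ && _); rewrite andbC.
have yD : y \in D by rewrite !inE yU ya nay connect0.
have DW x : x \in D -> [/\ x \in U, x != a & ~~ e a x].
  by rewrite !inE => /andP[/and3P[]].
have D_S x z : x \in D -> z \in U -> e x z -> (z \in D) || (z \in S).
  move=> xD zU xz; have [xU xa nax] := DW x xD.
  have za : z != a by apply: contraNneq nax => <-; rewrite e_sym.
  case az: (e a z); apply/orP; [right|left].
    by rewrite inE zU az; apply/exists_inP; exists x; rewrite // e_sym.
  move: xD; rewrite inE => /andP[xW yx].
  have zW : z \in W by rewrite inE zU za az.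
  rewrite inE zW; apply: connect_trans yx (connect1 _).
  by rewrite /= xz xW zW.
have S_clique : clique S.
  apply/cliqueP => s t; rewrite !inE => /and3P[sU sa /exists_inP[c cD sc]].
  case/and3P=> tU ta /exists_inP[d dD td] st; apply: contraT => nst.
  have C4 z : z \in D -> e s z -> e t z -> false.
    move=> zD sz tz; have [zU za naz] := DW z zD.
    have := @no_C4 a s z t; rewrite sa sz (e_sym z t) tz (e_sym t) ta.
    by rewrite eq_sym za (negbTE naz) (negbTE nst) => /(_ isT isT st).
  (* Adjacency to [s] spreads over [D]: if it stopped between [x] and [z], then [t a s x z] would be
     an induced 5-path or 5-cycle. Hence [d] sees both [s] and [t], contradicting [C4]. *)
  have step x z : r x z -> e s x -> e s z.
    case/and3P=> xz xW zW sx; apply: contraT => nsz.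
    move: xW zW; rewrite !inE => /and3P[xU xa nax] /and3P[zU za naz].
    have ntx : ~~ e t x.
      apply/negP => tx; have := @no_C4 a s x t; rewrite sa sx (e_sym x t) tx.
      rewrite (e_sym t) ta eq_sym xa (negbTE nax) (negbTE nst).
      by move=> /(_ isT isT st).
    have := @no_P5 t a s x z; rewrite (e_sym t a) ta sa sx xz => /(_ isT).
    rewrite (e_sym t s) nst ntx nax naz nsz !andbT negbK /= => tz.
    have := noC5 _ _ aU sU _ _ _ xU zU tU; rewrite /C5 sa sx xz (e_sym z) tz.
    by rewrite (e_sym t a) ta nax nsz (e_sym x) ntx (e_sym z) naz (e_sym t) nst.
  have cd : connect r c d.
    move: cD dD; rewrite !inE => /andP[_ yc] /andP[_ yd].
    by apply: connect_trans yd; rewrite r_sym.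
  have := closed_connect (intro_closed r_sym (a := [pred x | e s x]) step) cd.
  by rewrite !inE sc => sd; apply: C4 td; rewrite // -sd.
(* [U'] omits [a], so induction applies, and it contains all neighbours in [U] of vertices of [D].
   Hence a vertex of [D] simplicial in [U'] is simplicial in [U]. *)
pose U' := D :|: S.
have U'U : U' \subset U.
  by apply/subsetP => x; rewrite inE => /orP[/DW[] | ] //; rewrite inE => /andP[].
have aU' : a \notin U' by rewrite !inE eqxx e_irr !andbF.
have ltU' : #|U'| < n.
  have /proper_card/leq_trans: U' \proper U by apply/properP; split=> //; exists a.
  by apply.
have noC5' : {in U' &, forall p q, {in U' & &, forall r s t, ~~ C5 p q r s t}}.
  move=> p q /(subsetP U'U) pU /(subsetP U'U) qU u v w.
  by move=> /(subsetP U'U) uU /(subsetP U'U) vU /(subsetP U'U); apply: noC5.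
have goal x : x \in D -> clique (nbrs U' x) ->
    exists x, [/\ x \in U, x != a, ~~ e a x & clique (nbrs U x)].
  move=> xD xs; exists x; have [xU xa nax] := DW x xD; split=> //.
  have inU' z : z \in nbrs U x -> z \in nbrs U' x.
    by rewrite inE => /andP[zU xz]; rewrite 2!inE xz andbT; apply: D_S xD zU xz.
  by apply/cliqueP => u v /inU' uN /inU' vN; apply: (cliqueP _ xs).
have DS x : x \in D -> x \notin S by case/DW=> _ _ nax; rewrite inE (negbTE nax) andbF.
(* Induction from such an [s] gives a simplicial vertex not adjacent to [s], hence outside the
   clique [S] and so in [D]. *)
have [/exists_inP[s sS /exists_inP[c cD nsc]]|complete] :=
    boolP [exists s in S, exists c in D, ~~ e s c].
  have cs : c != s by apply: contraNneq (DS c cD) => ->.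
  have sU' : s \in U' by rewrite inE sS orbT.
  have cU' : c \in U' by rewrite inE cD.
  have [x [xU' xs nsx xsimp]] := IH _ s c ltU' noC5' sU' cU' cs nsc.
  apply: goal xsimp; move: xU'; rewrite inE => /orP[// | xS].
  by rewrite (cliqueP _ S_clique) // eq_sym in nsx.
have SD s c : s \in S -> c \in D -> e s c.
  move=> sS cD; apply: contraNT complete => nsc.
  by apply/exists_inP; exists s => //; apply/exists_inP; exists c.
have [D_clique | ] := boolP (clique D).
  apply: (goal y yD); apply/cliqueP => u v.
  move=> /setIdP[/setUP[uD|uS] _] /setIdP[/setUP[vD|vS] _] uv.
  - exact: (cliqueP _ D_clique).
  - by rewrite e_sym SD.
  - exact: SD.
  - exact: (cliqueP _ S_clique).
(* Now [S] is complete to [D], so a simplicial vertex not adjacent to some [c] in [D] cannot lie in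
   [S]. *)
rewrite negb_forall_in => /exists_inP[c cD].
rewrite negb_forall_in => /exists_inP[d dD].
rewrite negb_imply eq_sym => /andP[dc ncd].
have cU' : c \in U' by rewrite inE cD.
have dU' : d \in U' by rewrite inE dD.
have [x [xU' xc ncx xsimp]] := IH _ c d ltU' noC5' cU' dU' dc ncd.
apply: goal xsimp; move: xU'; rewrite inE => /orP[// | xS].
by rewrite e_sym SD in ncx.
Qed.

(** * Detachable sets and their existence *)

Definition no_stable3 (B : {set T}) :=
  {in B & &, forall x y z,
    x != y -> y != z -> x != z -> [|| e x y, e y z | e x z]}.

(** [B] is a module of the graph induced on [U], and the last clause makes [K] the common outside
    neighbourhood of its vertices. *)
Definition detachable (U B K : {set T}) :=
  [/\ B \subset U, B != set0, K \subset U :\: B, no_stable3 B & clique K] /\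
  {in B & U :\: B, forall b x, e b x = (x \in K)}.

Lemma detachable_simplicial (U : {set T}) x :
  x \in U -> clique (nbrs U x) -> detachable U [set x] (nbrs U x).
Proof.
move=> xU xs; split.
  split=> //; first by rewrite sub1set.
  - by apply/set0Pn; exists x; rewrite set11.
  - apply/subsetP => y; rewrite !inE => /andP[-> xy]; rewrite andbT.
    by apply: contraTneq xy => ->; rewrite e_irr.
  - by move=> u v w /set1P-> /set1P->; rewrite eqxx.
by move=> b y /set1P-> /setDP[yU _]; rewrite inE yU.
Qed.

(** The cycle may leave [U]: the structure is inherited by intersection with [U], and [a] in [U]
    makes the set nonempty. *)
Lemma detachable_mixed (U : {set T}) a b c d f :
  C5 a b c d f -> a \in U ->
  detachable U [set v in U | mixed a b c d f v] [set v in U | full a b c d f v].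
Proof.
move=> C aU; set B := finset _; have B_mixed v : v \in B -> mixed a b c d f v.
  by rewrite inE => /andP[].
split.
  split.
  - by apply/subsetP => v; rewrite inE => /andP[].
  - apply/set0Pn; exists a; rewrite inE aU.
    by case/and5P: C => ab _ _ _ _; rewrite /mixed ab e_irr orbT.
  - apply/subsetP => v; rewrite !inE => /andP[-> Fv]; rewrite !andbT /=.
    by rewrite /mixed negb_and negbK; move: Fv; rewrite /full => ->; rewrite orbT.
  - move=> x y z /B_mixed Mx /B_mixed My /B_mixed Mz.
    exact: mixed_no_stable3 C Mx My Mz.
  - apply/cliqueP => v w; rewrite !inE => /andP[_ Fv] /andP[_ Fw].
    exact: full_clique C Fv Fw.
move=> v w /B_mixed Mv /setDP[wU]; rewrite !inE wU /= => nMw.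
apply/idP/idP => [vw | Fw]; first exact: mixed_nbr_full C Mv nMw vw.
by rewrite e_sym; apply: full_mixed C Fw Mv.
Qed.

Lemma exists_detachable (U : {set T}) :
  U != set0 -> exists B K, detachable U B K.
Proof.
move=> /set0Pn[x xU].
have [/existsP[p /andP[pU C]]|noC5] :=
    boolP [exists p : T * T * T * T * T,
      (p.1.1.1.1 \in U) && C5 p.1.1.1.1 p.1.1.1.2 p.1.1.2 p.1.2 p.2].
  by do 2!eexists; apply: detachable_mixed C pU.
have {}noC5 : {in U &, forall p q, {in U & &, forall r s t, ~~ C5 p q r s t}}.
  move=> p q pU _ r s t _ _ _; apply: contraNN noC5 => C.
  by apply/existsP; exists (p, q, r, s, t); rewrite /= pU C.
suff [y [yU ys]]: exists y, y \in U /\ clique (nbrs U y).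
  by do 2!eexists; apply: detachable_simplicial ys.
have [U_clique | ] := boolP (clique U).
  exists x; split=> //; apply/cliqueP => u v /setIdP[uU _] /setIdP[vU _].
  exact: (cliqueP _ U_clique).
rewrite negb_forall_in => /exists_inP[c cU].
rewrite negb_forall_in => /exists_inP[d dU].
rewrite negb_imply eq_sym => /andP[dc ncd].
by have [y [yU _ _ ys]] := far_simplicial noC5 cU dU dc ncd; exists y.
Qed.

End Structure.

(** * Recolouring *)
Section Recolouring.
Variables (T : finType) (e : rel T) (C : finType).
Hypothesis e_sym : symmetric e.
Implicit Types (a b c : {ffun T -> C}) (B U X : {set T}) (P : {set C}).

(** Colourings stay total on [T], so passing to a subgraph changes no type. *)
Definition proper_on U c : bool :=
  [forall u in U, forall v in U, e u v ==> (c u != c v)].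

Lemma proper_onP U c :
  reflect (forall u v, u \in U -> v \in U -> e u v -> c u != c v)
          (proper_on U c).
Proof.
apply: (iffP forall_inP) => [h u v uU vU|h u uU].
  by have /forall_inP/(_ _ vU)/implyP := h u uU.
by apply/forall_inP => v vU; apply/implyP; apply: h.
Qed.

(** A step may leave the colouring unchanged, which spares proofs of an actual change and does not
    affect [connect]. *)
Definition recolour_in (Q : pred {ffun T -> C}) : rel {ffun T -> C} :=
  fun a b => [&& Q a, Q b & [exists v, [forall w, (w != v) ==> (a w == b w)]]].

Lemma recolour_in_sym Q a b :
  connect (recolour_in Q) a b = connect (recolour_in Q) b a.
Proof.
apply: sym_connect_sym => {}a {}b; rewrite /recolour_in andbCA.
do 2!congr (_ && _); apply: eq_existsb => v; apply: eq_forallb => w.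
by rewrite (eq_sym (a w)).
Qed.

Lemma recolour_in_mono (Q Q' : pred {ffun T -> C}) a b :
  (forall c, Q c -> Q' c) ->
  connect (recolour_in Q) a b -> connect (recolour_in Q') a b.
Proof.
move=> QQ'; apply: connect_sub => {}a {}b /and3P[/QQ' Qa /QQ' Qb ab].
by apply: connect1; rewrite /recolour_in Qa Qb ab.
Qed.

Definition hybrid X a b : {ffun T -> C} := [ffun x => if x \in X then b x else a x].

(** The vertices of [X] are switched one at a time; each intermediate colouring is the hybrid on a
    subset of [X]. *)
Lemma connect_hybrid (Q : pred {ffun T -> C}) X a b :
  (forall Y : {set T}, Y \subset X -> Q (hybrid Y a b)) ->
  connect (recolour_in Q) a (hybrid X a b).
Proof.
have [n] := ubnP #|X|; elim: n X => // n IH X ltX Qh.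
have [-> | /set0Pn[x xX]] := eqVneq X set0.
  by rewrite (_ : hybrid _ _ _ = a) //; apply/ffunP => x; rewrite ffunE inE.
have sub : X :\ x \subset X by apply: subD1set.
apply: connect_trans (IH (X :\ x) _ _) _.
- by move: ltX; rewrite (cardsD1 x) xX ltnS.
- by move=> Y /subset_trans/(_ sub); apply: Qh.
apply: connect1; rewrite /recolour_in !Qh //=.
apply/existsP; exists x; apply/forallP => w; apply/implyP => wx.
by rewrite !ffunE !inE wx.
Qed.

(** * Recolouring [B] inside a palette, with the rest of the graph frozen *)

Definition local B P a0 c : bool :=
  [&& proper_on B c, [forall v in B, c v \in P]
    & [forall v in ~: B, c v == a0 v]].

Lemma localP B P a0 c :
  reflect [/\ proper_on B c, {in B, forall v, c v \in P}
            & forall v, v \notin B -> c v = a0 v]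
          (local B P a0 c).
Proof.
apply: (iffP and3P) => -[pc cP ca]; split=> //.
- by move=> v vB; have /forall_inP := cP; apply.
- by move=> v vB; have /forall_inP/(_ v) := ca; rewrite inE => /(_ vB)/eqP.
- by apply/forall_inP.
- by apply/forall_inP => v; rewrite inE => /ca->.
Qed.

Definition paint X k a := hybrid X a [ffun=> k].

Lemma paintE X k a x : paint X k a x = if x \in X then k else a x.
Proof. by rewrite !ffunE. Qed.

(** Throughout, the vertices of [B] coloured [k] stay inside the stable set [X], so no conflict
    arises. *)
Lemma connect_paint B P a0 a X k :
  local B P a0 a -> X \subset B -> {in X &, forall x y, ~~ e x y} ->
  {in B, forall w, a w = k -> w \in X} -> k \in P ->
  local B P a0 (paint X k a) /\
  connect (recolour_in (local B P a0)) a (paint X k a).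
Proof.
move=> /localP[/proper_onP pa aP a0E] XB stX kX kP.
have loc (Y : {set T}) : Y \subset X -> local B P a0 (paint Y k a).
  move=> /subsetP YX; apply/localP; split=> [|v vB|v vB].
  - apply/proper_onP => u v uB vB uv; rewrite !paintE.
    case: ifP => uY; case: ifP => vY; last exact: pa.
    + by have := stX u v (YX u uY) (YX v vY); rewrite uv.
    + apply/negP => /eqP E; have vX := kX v vB (esym E).
      by have := stX u v (YX u uY) vX; rewrite uv.
    + apply/negP => /eqP E; have uX := kX u uB E.
      by have := stX u v uX (YX v vY); rewrite uv.
  - by rewrite paintE; case: ifP => // _; apply: aP.
  - rewrite paintE ifN; first exact: a0E.
    by apply: contra vB => /YX/(subsetP XB).
by split; [apply: loc | apply: connect_hybrid].
Qed.

Lemma color_class_stable B c k :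
  proper_on B c -> {in [set w in B | c w == k] &, forall x y, ~~ e x y}.
Proof.
move=> /proper_onP pc x y; rewrite !inE => /andP[xB /eqP cx] /andP[yB /eqP cy].
by apply/negP => /(pc x y xB yB); rewrite cx cy eqxx.
Qed.

(** On [B] the colour under [a] is a function [g] of the colour under [b]. *)
Lemma leq_imset_refine B a b :
  {in B &, forall u v, b u = b v -> a u = a v} -> #|a @: B| <= #|b @: B|.
Proof.
move=> ref; pose g k := if [pick w in B | b w == k] is Some w then a w else k.
have aE v : v \in B -> a v = g (b v).
  move=> vB; rewrite /g; case: pickP => [w /andP[wB /eqP bw] | /(_ v)].
    by apply: ref.
  by rewrite vB eqxx.
rewrite (eq_in_imset aE) (imset_comp g b); exact: leq_imset_card.
Qed.

Lemma spare_colour (A P : {set C}) : #|A| < #|P| -> exists2 k, k \in P & k \notin A.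
Proof.
move=> ltAP; apply/subsetPn; apply: contraTN ltAP => /subset_leq_card.
by rewrite -leqNgt.
Qed.

(* A spare colour lets us empty a colour and then give it to a whole class of [b],
   which repairs that class without spoiling another one. *)
Lemma connect_refined B P a0 a b :
  local B P a0 a -> local B P a0 b -> #|b @: B| < #|P| ->
  {in B &, forall u v, b u = b v -> a u = a v} ->
  connect (recolour_in (local B P a0)) a b.
Proof.
move=> + lb ltP; have [pb bP b0E] := localP _ _ _ _ lb.
have [n] := ubnP #|[set v in B | a v != b v]|.
elim: n a => // n IH a ltDn la ref; have [pa aP a0E] := localP _ _ _ _ la.
have [noD | /set0Pn[v]] := eqVneq [set v in B | a v != b v] set0.
  rewrite (_ : a = b) //; apply/ffunP => v.
  have [vB | vB] := boolP (v \in B); last by rewrite a0E ?b0E.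
  by have := in_set0 v; rewrite -noD inE vB /= => /negbFE/eqP.
rewrite inE => /andP[vB av].
have [z zP za] := spare_colour (leq_ltn_trans (leq_imset_refine ref) ltP).
pose k := b v; pose X := [set w in B | a w == k].
have [X_sub Y_sub] : X \subset B /\ [set w in B | b w == k] \subset B.
  by split; apply/subsetP => w; rewrite inE => /andP[].
(* Every vertex of [X] is misplaced: one with target colour [k] would lie in the [b]-class of [v],
   forcing [a v = k]. *)
have Xb w : w \in X -> b w != k.
  rewrite inE => /andP[wB /eqP aw]; apply: contraNneq av => bw.
  by rewrite -/k -aw; apply/eqP/ref.
have [] := @connect_paint B P a0 a X z la X_sub (color_class_stable pa) _ zP.
  by move=> w wB aw; rewrite -aw imset_f in za.
set a1 := paint X z a => la1 aa1; apply: connect_trans aa1 _.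
have a1k w : w \in B -> a1 w != k.
  move=> wB; rewrite paintE inE wB /=; have [aw | //] := eqVneq (a w) k.
  by apply: contraNneq za => ->; rewrite -aw imset_f.
have [] := @connect_paint B P a0 a1 [set w in B | b w == k] k la1 Y_sub
             (color_class_stable pb) _ (bP v vB).
  by move=> w wB a1w; have := a1k w wB; rewrite a1w eqxx.
set a2 := paint _ k a1 => la2 a12; apply: connect_trans a12 _.
apply: IH la2 _.
  rewrite -ltnS; apply: leq_trans ltDn; rewrite ltnS; apply: proper_card; apply/properP; split.
    apply/subsetP => w; rewrite !inE => /andP[wB]; rewrite wB paintE inE wB /=.
    have [-> | bw] := eqVneq (b w) k; first by rewrite eqxx.
    rewrite paintE; case: ifP => [wX | //] _.
    by move: wX; rewrite inE wB => /eqP ->; rewrite eq_sym.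
  by exists v; rewrite !inE vB ?av // paintE inE vB !eqxx.
(* Both painted sets are unions of [b]-classes, so the refinement survives. *)
move=> u w uB wB buw; by rewrite !paintE !inE uB wB buw (ref u w uB wB buw).
Qed.

Definition lonely B c u := [forall w in B, (c w == c u) ==> (w == u)].

(* Classes have at most two vertices: one contributes 1 + 1, or a lonely one 2. *)
Lemma sum_lonely B c :
  no_stable3 e B -> proper_on B c ->
  \sum_(v in B) (lonely B c v).+1 = 2 * #|c @: B|.
Proof.
move=> st3 pc; rewrite (partition_big_imset c) /= mulnC -sum_nat_const.
apply: eq_bigr => _ /imsetP[u uB ->]; rewrite (bigD1 u) /=; last by rewrite uB /=.
have [lu | ] := boolP (lonely B c u).
  rewrite big1 // => w /andP[/andP[wB cw] wu]; have /forall_inP := lu.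
  by move=> /(_ w wB); rewrite cw (negbTE wu).
rewrite negb_forall_in => /exists_inP[w wB]; rewrite negb_imply => /andP[cw wu].
have nl : ~~ lonely B c w.
  rewrite negb_forall_in; apply/exists_inP; exists u => //.
  by rewrite negb_imply eq_sym cw eq_sym.
rewrite (bigD1 w) /= ?wB ?cw // (negbTE nl) big1 // => x.
move=> /andP[/andP[/andP[xB cx] xu] xw].
have := st3 u w x uB wB xB; rewrite eq_sym wu eq_sym xw eq_sym xu.
move=> /(_ isT isT isT); have /proper_onP pc' := pc.
by case/or3P=> /pc'; rewrite ?uB ?wB ?xB ?(eqP cw) ?(eqP cx) eqxx => /(_ isT isT).
Qed.

(** By [sum_lonely], the number of lonely vertices is twice the number of colours minus the size of
    [B]. So [a] has more of them than [b], and some [u] lonely for [a] has a partner under [b]. *)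
Lemma lonely_pair B a b :
  no_stable3 e B -> proper_on B a -> proper_on B b -> #|b @: B| < #|a @: B| ->
  exists u v, [/\ u \in B, v \in B, u != v, b u = b v & lonely B a u].
Proof.
move=> st3 pa pb ltba.
suff: [exists u in B, lonely B a u && ~~ lonely B b u].
  case/exists_inP=> u uB /andP[lu]; rewrite negb_forall_in => /exists_inP[v vB].
  by rewrite negb_imply eq_sym => /andP[/eqP buv vu]; exists u, v; rewrite eq_sym.
apply: contraTT ltba; rewrite negb_exists_in -leqNgt => /forall_inP h.
rewrite -(leq_pmul2l (isT : 0 < 2)) -!sum_lonely //.
apply: leq_sum => u uB; have := h u uB; rewrite negb_and negbK ltnS.
by case: (lonely B a u) => //= ->.
Qed.

(* While some class of [b] is not monochromatic under [a], make it so with an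
   unused colour or, failing that, with the colour of a singleton class of [a];
   no other class of [b] is split. *)
Lemma connect_few_colours B P a0 a b :
  no_stable3 e B -> local B P a0 a -> local B P a0 b -> #|b @: B| < #|P| ->
  connect (recolour_in (local B P a0)) a b.
Proof.
move=> st3 + lb ltP; have [pb bP b0E] := localP _ _ _ _ lb.
(* The induction measure; once it vanishes, [connect_refined] applies. *)
pose bad c := [set p in setX B B | (b p.1 == b p.2) && (c p.1 != c p.2)].
have [n] := ubnP #|bad a|.
elim: n a => // n IH a ltDn la; have [pa aP a0E] := localP _ _ _ _ la.
have [noD | /set0Pn[p pbad]] := eqVneq (bad a) set0.
  apply: connect_refined => // u v uB vB buv; apply: contraTeq isT => auv.
  by have := in_set0 (u, v); rewrite -noD inE in_setX uB vB buv eqxx auv.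
have [u [v [k]]] : exists u v k, [/\ u \in B, v \in B, b u = b v, a u != a v & k \in P] /\
    {in B, forall w, a w = k -> w \in [set u; v]}.
  have [ltaP | leaP] := ltnP #|a @: B| #|P|.
    have [z zP za] := spare_colour ltaP; move: pbad; rewrite inE [p]surjective_pairing in_setX.
    case/and3P=> /andP[uB vB] /eqP buv auv; exists p.1, p.2, z; split=> // w wB aw.
    by rewrite -aw imset_f in za.
  have [u [v [uB vB uv buv lu]]] := lonely_pair st3 pa pb (leq_trans ltP leaP).
  have {}lu w : w \in B -> a w = a u -> w = u.
    by move=> wB aw; have /forall_inP/(_ w wB) := lu; rewrite aw eqxx => /eqP.
  exists u, v, (a u); split; last by move=> w wB /lu->; rewrite // set21.
  split=> //; last exact: aP.
  by rewrite eq_sym; apply: contraNneq uv => /lu ->.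
case=> -[uB vB buv auv kP] kuv; have uv : u != v by apply: contraNneq auv => ->.
(* A third vertex would complete a stable triple, so [u] and [v] form a whole [b]-class, and
   painting them creates no new bad pair. *)
have st w : w \in B -> b w = b u -> w \in [set u; v].
  move=> wB bw; rewrite !inE; apply: contraT; rewrite negb_or => /andP[wu wv].
  have := st3 u v w uB vB wB uv; rewrite ![_ == w]eq_sym wu wv.
  move=> /(_ isT isT); have /proper_onP pb' := pb.
  by case/or3P=> /pb'; rewrite ?uB ?vB ?wB ?bw ?buv eqxx => /(_ isT isT).
have [||||la1 aa1] := @connect_paint B P a0 a [set u; v] k la => //.
- by apply/subsetP => w; rewrite !inE => /orP[] /eqP->.
- move=> x y xuv yuv; apply: (color_class_stable (k := b u) pb); rewrite inE.
    by move: xuv; rewrite !inE => /orP[] /eqP->; rewrite ?uB ?vB ?buv eqxx.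
  by move: yuv; rewrite !inE => /orP[] /eqP->; rewrite ?uB ?vB ?buv eqxx.
apply: connect_trans aa1 _; apply: IH la1.
rewrite -ltnS; apply: leq_trans ltDn; rewrite ltnS; apply: proper_card; apply/properP; split.
  apply/subsetP => -[x y]; rewrite !inE /= => /and3P[/andP[xB yB] /eqP bxy].
  rewrite xB yB bxy eqxx /= !paintE.
  have xyuv : (x \in [set u; v]) = (y \in [set u; v]).
    have buv' z w : z \in [set u; v] -> w \in B -> b z = b w -> w \in [set u; v].
      by move=> /set2P[] E wB bzw; apply: st; rewrite // -bzw E ?buv.
    by apply/idP/idP => /buv'; apply.
  by rewrite xyuv; case: ifP; rewrite // eqxx.
exists (u, v); first by rewrite !inE uB vB buv eqxx auv.
by rewrite !inE !paintE set21 set22 eqxx !andbF.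
Qed.

Lemma exists_inj_into (A D : {set C}) :
  #|A| <= #|D| -> exists g : C -> C, {in A &, injective g} /\ {in A, forall k, g k \in D}.
Proof.
have [-> _ | /set0Pn[k0 k0A] leAD] := eqVneq A set0.
  by exists id; split=> k; rewrite inE.
have idx k : k \in A -> index k (enum A) < size (enum D).
  by move=> kA; rewrite -cardE; apply: leq_trans leAD; rewrite cardE index_mem mem_enum.
exists (fun k => nth k0 (enum D) (index k (enum A))); split=> [x y xA yA|k kA].
  move=> /eqP; rewrite nth_uniq ?idx ?enum_uniq // => /eqP.
  by apply: (index_inj k0); rewrite mem_enum.
by have := mem_nth k0 (idx k kA); rewrite mem_enum.
Qed.

(** * Extending recolourings from [U :\: B] to [U] *)

Section Gluing.
Variables (U B K : {set T}) (f : {ffun T -> C}).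
Hypotheses (detB : detachable e U B K) (proper_f : proper_on U f).
Hypothesis few_f : #|f @: U| < #|C|.

Let BU : B \subset U. Proof. by case: detB => -[]. Qed.
Let KU : K \subset U :\: B. Proof. by case: detB => -[]. Qed.
Let eBK : {in B & U :\: B, forall u v, e u v = (v \in K)}. Proof. by case: detB. Qed.

(** On the clique [K], [f] uses [#|K|] colours, all absent from [B], so [#|K| + #|f @: B|] is less
    than [#|C|], while [a] blocks at most [#|K|] colours. *)
Lemma palette_large a : #|f @: B| < #|~: (a @: K)|.
Proof.
have /proper_onP pf := proper_f; have [[_ _ _ _ /cliqueP Kc] _] := detB.
have KB x : x \in K -> x \in U /\ x \notin B.
  by move/(subsetP KU)/setDP.
have Kinj : {in K &, injective f}.
  move=> x y xK yK; apply: contra_eq => xy.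
  by apply: pf (Kc x y xK yK xy); [case: (KB x xK) | case: (KB y yK)].
have dis : [disjoint f @: K & f @: B].
  rewrite disjoints_subset; apply/subsetP => _ /imsetP[x xK ->]; rewrite inE.
  apply/negP => /imsetP[v vB fxv]; have [xU xB] := KB x xK.
  have := pf v x (subsetP BU v vB) xU; rewrite eBK ?(subsetP KU) // xK fxv eqxx.
  by move=> /(_ isT).
have le : #|K| + #|f @: B| <= #|f @: U|.
  rewrite -(card_in_imset Kinj) -cardsUI disjoint_setI0 // cards0 addn0.
  rewrite -imsetU; apply/subset_leq_card/imsetS.
  by rewrite subUset BU (subset_trans KU) ?subsetDl.
have := cardsC (a @: K); rewrite -(ltn_add2l #|a @: K|) => ->.
apply: leq_ltn_trans few_f; apply: leq_trans le.
by rewrite leq_add2r leq_imset_card.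
Qed.

Lemma local_proper_on a c :
  proper_on U a -> local B (~: (a @: K)) a c -> proper_on U c.
Proof.
move=> /proper_onP pa /localP[/proper_onP pc cP cE].
have cross u v : u \in B -> v \in U -> v \notin B -> e u v -> c u != c v.
  move=> uB vU vB uv; have vK : v \in K by rewrite -(eBK uB) // inE vB vU.
  by apply: contraTneq (cP u uB) => ->; rewrite inE negbK cE ?imset_f.
apply/proper_onP => u v uU vU uv.
have [uB | uB] := boolP (u \in B); have [vB | vB] := boolP (v \in B).
- exact: pc.
- exact: cross.
- by rewrite eq_sym cross // e_sym.
- by rewrite !cE // pa.
Qed.

(** Converse of [local_proper_on]: completeness of [B] to [K] keeps the colours of [K] off [B]. *)
Lemma proper_local a c :
  proper_on U a -> proper_on U c -> (forall v, v \notin B -> c v = a v) ->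
  local B (~: (a @: K)) a c.
Proof.
move=> pa /proper_onP pc cE; apply/localP; split=> //.
  by apply/proper_onP => u v uB vB; apply: pc; apply: (subsetP BU).
move=> v vB; rewrite inE; apply/negP => /imsetP[x xK].
have /setDP[xU xB] := subsetP KU x xK.
rewrite -cE //; apply/eqP/pc => //; first exact: (subsetP BU).
by rewrite eBK // (subsetP KU).
Qed.

(** The colours of [f] on [B] are renamed injectively into [D]. *)
Lemma exists_few_colours a (D : {set C}) :
  D \subset ~: (a @: K) -> #|f @: B| <= #|D| ->
  exists c, [/\ local B (~: (a @: K)) a c, #|c @: B| < #|~: (a @: K)|
               & {in B, forall v, c v \in D}].
Proof.
move=> DP leD; have [g [ginj gD]] := exists_inj_into leD.
pose c := hybrid B a [ffun x => g (f x)].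
have cB v : v \in B -> c v = g (f v) by move=> vB; rewrite !ffunE vB.
have cD v : v \in B -> c v \in D by move=> vB; rewrite cB ?gD ?imset_f.
exists c; split=> //.
  apply/localP; split=> [|v vB|v vB].
  - apply/proper_onP => u v uB vB uv; rewrite !cB //.
    have /proper_onP pf := proper_f; have := pf u v.
    rewrite !(subsetP BU) // => /(_ isT isT uv); apply: contraNneq.
    by move/ginj->; rewrite ?imset_f.
  - exact: (subsetP DP) (cD v vB).
  - by rewrite !ffunE (negbTE vB).
rewrite (eq_in_imset cB) (imset_comp g f).
exact: leq_ltn_trans (leq_imset_card _ _) (palette_large a).
Qed.

Lemma recolour_B_into a (D : {set C}) :
  proper_on U a -> D \subset ~: (a @: K) -> #|f @: B| <= #|D| ->
  exists a', [/\ connect (recolour_in (proper_on U)) a a', proper_on U a',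
    {in B, forall v, a' v \in D} & forall v, v \notin B -> a' v = a v].
Proof.
move=> pa DP leD; have [[_ _ _ st3 _] _] := detB.
have [c [lc few_c cD]] := exists_few_colours DP leD; exists c; split=> //.
- apply: recolour_in_mono (fun c => local_proper_on pa) _.
  by apply: connect_few_colours => //; apply: proper_local.
- exact: local_proper_on lc.
- by case/localP: lc.
Qed.

(** [connect_few_colours] wants a target with a spare colour, so both colourings are led to a common
    [c] of that kind. *)
Lemma connect_same_off_B a b :
  proper_on U a -> proper_on U b -> (forall v, v \notin B -> b v = a v) ->
  connect (recolour_in (proper_on U)) a b.
Proof.
move=> pa pb ab; have [[_ _ _ st3 _] _] := detB.
have [c [lc few_c _]] := exists_few_colours (subxx _) (ltnW (palette_large a)).
apply: recolour_in_mono (fun c => local_proper_on pa) _.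
apply: (@connect_trans _ _ c); last rewrite recolour_in_sym;
  by apply: connect_few_colours => //; apply: proper_local.
Qed.

(* Before a vertex outside [B] receives the colour [k], clear [k] from [B]. *)
Lemma follow_step a b a' :
  recolour_in (proper_on (U :\: B)) a b ->
  proper_on U a' -> (forall v, v \notin B -> a' v = a v) ->
  exists b', [/\ connect (recolour_in (proper_on U)) a' b', proper_on U b'
                & forall v, v \notin B -> b' v = b v].
Proof.
case/and3P=> _ /proper_onP pb /existsP[v /forallP abv] pa' a'E.
have {}abv w : w != v -> a w = b w by move=> wv; have /implyP/(_ wv)/eqP := abv w.
(* A change inside [B] is invisible outside it, so [a'] itself serves. *)
have [vB | vB] := boolP (v \in B).
  exists a'; split=> // w wB; rewrite a'E // abv //.
  by apply: contraNneq wB => ->.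
(* The strict bound of [palette_large] pays for the removal of one colour. *)
have [] := @recolour_B_into a' (~: (a' @: K) :\ b v) pa' (subD1set _ _).
  rewrite -ltnS; apply: leq_trans (palette_large a') _.
  by rewrite (cardsD1 (b v) (~: _)) -add1n leq_add2r leq_b1.
move=> c [a'c pc cD cE]; have cbB w : w \in B -> c w != b v.
  by move/cD; rewrite in_setD1 => /andP[].
exists (paint [set v] (b v) c).
have cv w : w \notin B -> paint [set v] (b v) c w = b w.
  move=> wB; rewrite paintE inE; have [-> // | wv] := eqVneq w v.
  by rewrite cE // a'E // abv.
have cB w : w \in B -> paint [set v] (b v) c w = c w.
  by move=> wB; rewrite paintE inE ifN //; apply: contraTneq wB => ->.
have cross x y : x \in U -> y \in U -> x \in B -> y \notin B -> e x y ->
    c x != b y.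
  move=> xU yU xB yB xy; have [-> | yv] := eqVneq y v; first exact: cbB.
  move/proper_onP: pc => /(_ x y xU yU xy).
  by rewrite (cE y) // a'E // abv.
have pb' : proper_on U (paint [set v] (b v) c).
  apply/proper_onP => x y xU yU xy.
  have [xB | xB] := boolP (x \in B); have [yB | yB] := boolP (y \in B).
  - by rewrite !cB //; move/proper_onP: pc; apply.
  - by rewrite cB ?cv // cross.
  - by rewrite cv ?cB // eq_sym cross // e_sym.
  - by rewrite !cv // pb // inE ?xB ?yB.
split=> //; apply: connect_trans a'c _; apply: connect1.
rewrite /recolour_in pc pb'; apply/existsP; exists v; apply/forallP => w.
by apply/implyP => wv; rewrite paintE inE (negbTE wv).
Qed.

(** Lifting a path from [a] to [b] step by step ends at a colouring that agrees with [b] off [B];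
    [connect_same_off_B] then corrects [B]. *)
Lemma connect_glue :
  (forall a b, proper_on (U :\: B) a -> proper_on (U :\: B) b ->
     connect (recolour_in (proper_on (U :\: B))) a b) ->
  forall a b, proper_on U a -> proper_on U b ->
     connect (recolour_in (proper_on U)) a b.
Proof.
move=> IH a b pa pb; have sub c : proper_on U c -> proper_on (U :\: B) c.
  move=> /proper_onP pc; apply/proper_onP => u v /setDP[uU _] /setDP[vU _].
  exact: pc.
have /connectP[s path_s bE] := IH a b (sub a pa) (sub b pb).
have follow a' : proper_on U a' -> (forall v, v \notin B -> a' v = a v) ->
    exists b', [/\ connect (recolour_in (proper_on U)) a' b', proper_on U b'
                  & forall v, v \notin B -> b' v = b v].
  rewrite bE; elim: s a a' path_s {pa bE} => [|c s IHs] a1 a' /=; first by exists a'.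
  case/andP=> st path_s pa' a'E.
  have [c' [a'c' pc' c'E]] := follow_step st pa' a'E.
  have [b' [c'b' pb' b'E]] := IHs c c' path_s pc' c'E.
  by exists b'; split=> //; apply: connect_trans a'c' c'b'.
have [b' [ab' pb' b'E]] := follow a pa (fun _ _ => erefl).
by apply: connect_trans ab' (connect_same_off_B pb' pb _) => v /b'E.
Qed.

End Gluing.

Lemma connect_proper_on (e_irr : irreflexive e) (e_free : P5_C4_free e) U
    (f : {ffun T -> C}) :
  proper_on U f -> #|f @: U| < #|C| ->
  forall a b, proper_on U a -> proper_on U b ->
  connect (recolour_in (proper_on U)) a b.
Proof.
have [n] := ubnP #|U|; elim: n U => // n IH U ltU pf few_f.
have [-> a b _ _ | U0] := eqVneq U set0.
  (* Every colouring is proper on the empty set, so vertices can be switched freely. *)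
  have := @connect_hybrid (proper_on set0) setT a b.
  rewrite (_ : hybrid _ _ _ = b); last by apply/ffunP => x; rewrite ffunE inE.
  by apply=> Y _; apply/proper_onP => u v; rewrite inE.
have [B [K detB]] := exists_detachable e_sym e_irr e_free U0.
have [[BU B0 _ _ _] _] := detB.
apply: (connect_glue detB pf few_f); apply: IH.
- rewrite -ltnS; apply: leq_trans ltU; rewrite ltnS proper_card //.
  have /set0Pn[x xB] := B0; apply/properP; split; first exact: subsetDl.
  by exists x; rewrite ?inE ?xB // (subsetP BU).
- by apply/proper_onP => u v /setDP[uU _] /setDP[vU _]; move/proper_onP: pf; apply.
- by apply: leq_ltn_trans few_f; apply/subset_leq_card/imsetS/subsetDl.
Qed.

End Recolouring.

(** * From the chromatic number to the theorem *)

Lemma chi_colourable (T : finType) (e : rel T) :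
  irreflexive e -> colourable e (chi e).
Proof.
move=> e_irr; have h : has (colourable e) (iota 0 #|T|.+1).
  apply/hasP; exists #|T|; first by rewrite mem_iota add0n leq0n ltnS leqnn.
  apply/existsP; exists [ffun x => enum_rank x]; apply/forallP => u.
  apply/forallP => v; apply/implyP => uv; rewrite !ffunE.
  by apply: contraTneq uv => /enum_rank_inj ->; rewrite e_irr.
have := nth_find 0 h; rewrite nth_iota ?add0n //.
by move: h; rewrite has_find size_iota.
Qed.

Theorem theorem8 (T : finType) (e : rel T) (l : nat) :
  simple_graph e -> P5_C4_free e -> chi e + 1 <= l ->
  recol_connected e l.
Proof.
case=> e_sym e_irr e_free; rewrite addn1 => lt_l a b pa pb.
have proper_setT c : proper_col e c = proper_on e setT c.
  apply/forallP/proper_onP => [h u v _ _ uv | h u].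
    by have /forallP/(_ v)/implyP := h u; apply.
  by apply/forallP => v; apply/implyP; apply: h.
have /existsP[f pf] := chi_colourable e_irr.
(* An optimal colouring, read with [l] colours, misses at least one: this is the reference colouring
   of the induction. *)
pose g : {ffun T -> 'I_l} := [ffun x => widen_ord (ltnW lt_l) (f x)].
have pg : proper_on e setT g.
  rewrite -proper_setT; apply/forallP => u; apply/forallP => v; apply/implyP => uv.
  have /forallP/(_ u)/forallP/(_ v)/implyP/(_ uv) := pf; rewrite !ffunE.
  by apply: contraNneq => /(congr1 val)/= E; apply/eqP/val_inj.
have few_g : #|g @: setT| < #|'I_l|.
  rewrite card_ord; apply: leq_ltn_trans (lt_l); rewrite -[leqRHS]card_ord.
  have -> : g @: setT = widen_ord (ltnW lt_l) @: (f @: setT).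
    by rewrite -imset_comp; apply: eq_imset => x; rewrite ffunE.
  exact: leq_trans (leq_imset_card _ _) (max_card _).
rewrite proper_setT in pa; rewrite proper_setT in pb.
apply: connect_sub (connect_proper_on e_sym e_irr e_free pg few_g pa pb).
move=> {pa pb}a {}b /and3P[pa pb /existsP[v /forallP ab]].
(* Idle steps are dropped here, since [recol_adj] demands exactly one change. *)
have [-> | ne] := eqVneq a b; first exact: connect0.
apply: connect1; rewrite /recol_adj !proper_setT pa pb /=; apply/cards1P.
have {}ab w : w != v -> a w = b w by move=> wv; have /implyP/(_ wv)/eqP := ab w.
exists v; apply/setP => w; rewrite !inE; have [-> | /ab->] := eqVneq w v.
  apply: contraNneq ne => av; apply/eqP/ffunP => x.
  by have [-> | /ab] := eqVneq x v.
by rewrite eqxx.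
Qed.
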